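(* Let $(X,d)$ be a metric space, $F:X\to[0,+\infty]$, and $x:[0,\infty)\to X$. Let $z\in\mathrm{zer}F$ and $b>0$ with $d(x(t),z)\leq b$ for all $t\geq0$, and assume that $F$ has a modulus of regularity $\tau$ w.r.t. $\overline{B}_b(z)$. Let $G,H:[0,\infty)\to[0,\infty)$ and $g,h:(0,\infty)\to(0,\infty)$ be such that for all $a\geq0$, $\varepsilon>0$: $a<g(\varepsilon)\to G(a)<\varepsilon$ and $H(a)<h(\varepsilon)\to a<\varepsilon$. Let $e$ be a real-valued function of pairs $0\leq s\leq t$ such that $H(d(x(t),y))\leq G(d(x(s),y))+e(s,t)$ for all $y\in\mathrm{zer}F$ and $t\geq s\geq0$. (a) Assume that $\varphi:(0,\infty)\times\mathbb{N}\to\mathbb{N}$ satisfies $\forall\varepsilon>0\ \forall n\in\mathbb{N}\ \exists t\in[n,\varphi(\varepsilon,n)]\ (F(x(t))<\varepsilon)$ and that $\eta:(0,\infty)\to\mathbb{N}$ satisfies $\forall\varepsilon>0\ \forall t\geq s\geq\eta(\varepsilon)\ (|e(s,t)|<\varepsilon)$. Then, with $\rho(\varepsilon):=\varphi(\tau(g(h(\varepsilon)/2)),\eta(h(\varepsilon)/2))+1$, \[ \forall\varepsilon>0\ \forall t\geq\rho(\varepsilon)\ (\mathrm{dist}(x(t),\mathrm{zer}F)<\varepsilon)\quad\text{and}\quad\forall\varepsilon>0\ \forall s,t\geq\rho(\varepsilon/2)\ (d(x(t),x(s))<\varepsilon). \] (b) If $e\equiv0$ and $\varphi:(0,\infty)\to\mathbb{N}$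 satisfies $\forall\varepsilon>0\ \exists t\leq\varphi(\varepsilon)\ (F(x(t))<\varepsilon)$, then both conclusions displayed in (a) hold with $\rho(\varepsilon):=\varphi(\tau(g(h(\varepsilon))))+1$. (c) If $X$ is complete and $\mathrm{zer}F$ is closed, then in each of the cases (a) and (b), $x(t)$ converges as $t\to\infty$ to some point $x^*\in\mathrm{zer}F$ with rate $\rho(\varepsilon/2)$, i.e. $d(x(t),x^* )\leq\varepsilon$ for all $\varepsilon>0$ and $t\geq\rho(\varepsilon/2)$, with the respective $\rho$.
   Context: $\mathbb{N}$ contains $0$. $\mathrm{zer}F:=\{y\in X\mid F(y)=0\}$ and $\overline{B}_r(z):=\{y\in X\mid d(z,y)\leq r\}$. For $z\in\mathrm{zer}F$ and $r>0$, a modulus of regularity for $F$ w.r.t. $\overline{B}_r(z)$ is a function $\tau:(0,\infty)\to(0,\infty)$ such that for all $\varepsilon>0$ and all $u\in\overline{B}_r(z)$: $F(u)<\tau(\varepsilon)$ implies $\mathrm{dist}(u,\mathrm{zer}F)<\varepsilon$. *)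

(* Defs.v *)
From HB Require Import structures.
From mathcomp Require Import all_boot all_order all_algebra.
From mathcomp Require Import all_classical all_reals all_analysis.

Set Implicit Arguments.
Unset Strict Implicit.
Unset Printing Implicit Defensive.

Import Order.TTheory GRing.Theory Num.Theory.
Import numFieldNormedType.Exports.

Local Open Scope classical_set_scope.
Local Open Scope ring_scope.

(* Functions with domain [0, +oo[ or ]0, +oo[ are encoded as total functions on
   R: all statements only involve their values on the intended domain. *)

Section Defs.
Context {R : realType} {X : metricType R}.

Definition zer (F : X -> \bar R) : set X := [set y | F y = 0%E].

(* The library's [closed_ball] is the closure of the open ball, which may be
   strictly smaller than this set in a general metric space. *)
Definition cball (z : X) (r : R) : set X := [set y | mdist z y <= r].

(* Only meaningful when [A] is nonempty, since [inf set0 = 0]. *)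
Definition dist (u : X) (A : set X) : R := inf [set mdist u y | y in A].

Definition modulus_of_regularity (F : X -> \bar R) (z : X) (r : R)
    (tau : R -> R) : Prop :=
  (forall eps, 0 < eps -> 0 < tau eps) /\
  (forall eps u, 0 < eps -> cball z r u ->
     (F u < (tau eps)%:E)%E -> dist u (zer F) < eps).

Definition liminf_bound (F : X -> \bar R) (x : R -> X) (phi : R -> nat -> nat)
    : Prop :=
  forall eps (n : nat), 0 < eps ->
    exists t : R, n%:R <= t <= (phi eps n)%:R /\ (F (x t) < eps%:E)%E.

Definition approx_zero_bound (F : X -> \bar R) (x : R -> X) (phi : R -> nat)
    : Prop :=
  forall eps, 0 < eps ->
    exists t : R, 0 <= t <= (phi eps)%:R /\ (F (x t) < eps%:E)%E.

Definition error_rate (e : R -> R -> R) (eta : R -> nat) : Prop :=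
  forall eps s t, 0 < eps -> (eta eps)%:R <= s -> s <= t -> `|e s t| < eps.

Definition dist_rate (F : X -> \bar R) (x : R -> X) (rho : R -> nat) : Prop :=
  forall eps t, 0 < eps -> (rho eps)%:R <= t -> dist (x t) (zer F) < eps.

Definition cauchy_rate (x : R -> X) (rho : R -> nat) : Prop :=
  forall eps s t, 0 < eps -> (rho eps)%:R <= s -> (rho eps)%:R <= t ->
    mdist (x t) (x s) < eps.

Definition converges_with_rate (x : R -> X) (l : X) (rho : R -> nat) : Prop :=
  x t @[t --> +oo] --> l /\
  (forall eps t, 0 < eps -> (rho eps)%:R <= t -> mdist (x t) l <= eps).

End Defs.

(* Metric completeness as a predicate; the library's [completeType] bundles it
   with a distinguished point. *)
Definition metric_complete (R : realType) (X : metricType R) : Prop :=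
  forall u : nat -> X, cauchy (u n @[n --> \oo]) ->
    exists l : X, u n @[n --> \oo] --> l.

(* Main.v *)
Require Import Defs.
From HB Require Import structures.
From mathcomp Require Import all_boot all_order all_algebra.
From mathcomp Require Import all_classical all_reals all_analysis.

Set Implicit Arguments.
Unset Strict Implicit.
Unset Printing Implicit Defensive.

Import Order.TTheory GRing.Theory Num.Theory.
Import numFieldNormedType.Exports.

Local Open Scope classical_set_scope.
Local Open Scope ring_scope.

(** Fejér monotonicity turns a single visit near a zero into permanent
    proximity to that same zero.  Suppose that [F (x s)] is below the modulus of
    regularity at [g c].  Then some zero [y] of [F] has
    [mdist (x s) y < g c], so [G (mdist (x s) y) < c]; as soon as the later
    errors satisfy [c + e s t <= h eps], the Fejér inequality gives
    [H (mdist (x t) y) < h eps], whence [mdist (x t) y < eps], for all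
    [t >= s] ([visit_capture]).  With errors one splits [h eps] into two halves,
    one for [G] and one for [e]; without errors [c] is the whole of [h eps].

    The resulting property, [zero_capture], is the common core of all the
    assertions: one zero per [eps] serves all times beyond [rho eps].  It bounds
    the distance to the zeros, and it makes [x] Cauchy, since two points close
    to the same zero are close to each other.  In a complete space [x] then has a
    limit, with the Cauchy rate as rate of convergence, and this limit lies in
    the closure of the zeros. *)

(** The zero [y] is chosen before the time [t]; with these quantifiers
    exchanged the property would only bound the distance to the zeros, and
    would not give the Cauchy property. *)
Definition zero_capture (R : realType) (X : metricType R)
    (F : X -> \bar R) (x : R -> X) (rho : R -> nat) : Prop :=
  forall eps : R, 0 < eps -> exists2 y, zer F y &
    forall t : R, (rho eps)%:R <= t -> mdist (x t) y < eps.

Section Distance.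
Context {R : realType} {X : metricType R}.
Implicit Types (A : set X) (u y : X).

Lemma dist_le_mdist A u y : A y -> dist u A <= mdist u y.
Proof.
by move=> Ay; apply: ge_inf; [exists 0 => _ [w _ <-]; exact: mdist_ge0 | exists y].
Qed.

Lemma dist_lt_ex A u (eps : R) : A !=set0 -> dist u A < eps ->
  exists2 y, A y & mdist u y < eps.
Proof.
move=> [y Ay] /inf_lt -/(_ (ex_intro _ _ (imageP (mdist u) Ay))).
by move=> [_ [w Aw <-]]; exists w.
Qed.

End Distance.

Section Capture.
Context {R : realType} {X : metricType R}.
Implicit Types (F : X -> \bar R) (x : R -> X) (rho : R -> nat).

Lemma zero_capture_dist_rate F x rho : zero_capture F x rho -> dist_rate F x rho.
Proof.
move=> cap eps t /cap[y zFy +] rho_t => /(_ t rho_t).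
exact/le_lt_trans/dist_le_mdist.
Qed.

Lemma zero_capture_cauchy_rate F x rho :
  zero_capture F x rho -> cauchy_rate x (fun eps => rho (eps / 2)).
Proof.
move=> cap eps s t eps_gt0 rho_s rho_t.
have eps2_gt0 : 0 < eps / 2 by rewrite divr_gt0.
have [y _ xy] := cap _ eps2_gt0.
apply: le_lt_trans (metric_triangle _ y _) _.
by rewrite (splitr eps) (metric_sym y) ltrD// xy.
Qed.

(** Completeness is applied to the values at integer times. The limit inherits
    the Cauchy rate with a weak inequality, as one lets the second time tend to
    infinity. *)
Lemma cauchy_rate_converges x rho : metric_complete X -> cauchy_rate x rho ->
  exists l, converges_with_rate x l rho.
Proof.
move=> Xcomplete cauchy_x.
have [|l xl] := Xcomplete (fun n => x n%:R).
  apply: cauchy_exP => eps eps_gt0; exists (x (rho eps)%:R).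
  suff: \forall n \near \oo, ball (x (rho eps)%:R) eps (x n%:R) by [].
  near=> n; rewrite ballEmdist/=; apply: cauchy_x => //.
  by rewrite ler_nat; near: n; exact: nbhs_infty_ge.
have rate (eps t : R) : 0 < eps -> (rho eps)%:R <= t -> mdist (x t) l <= eps.
  move=> eps_gt0 rho_t; apply/ler_addgt0Pr => d d_gt0.
  have /cvg_ballP/(_ d d_gt0) xl_d := xl.
  near \oo => n.
  apply: le_trans (metric_triangle _ (x n%:R) _) _; apply: lerD.
    apply/ltW/cauchy_x => //.
    by rewrite ler_nat; near: n; exact: nbhs_infty_ge.
  rewrite metric_sym; apply/ltW.
  suff: ball l d (x n%:R) by rewrite ballEmdist.
  by near: n.
exists l; split=> //; apply/cvg_ballP => eps eps_gt0.
suff: \forall t \near +oo, ball l eps (x t) by [].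
near=> t; rewrite ballEmdist/= metric_sym.
apply: (@le_lt_trans _ _ (eps / 2)).
  apply: rate; first by rewrite divr_gt0.
  by near: t; apply: nbhs_pinfty_ge; exact: num_real.
by rewrite ltr_pdivrMr// ltr_pMr// ltr1n.
Unshelve. all: by end_near. Qed.

(** A capturing zero and the limit are both close to [x t] for large [t], so
    the limit is adherent to the zeros. *)
Lemma zero_capture_limit F x rho l : closed (zer F) -> zero_capture F x rho ->
  x t @[t --> +oo] --> l -> zer F l.
Proof.
move=> zF_closed cap xl; apply: zF_closed => B /nbhs_ballP[eps /= eps_gt0 lB].
have eps2_gt0 : 0 < eps / 2 by rewrite divr_gt0.
have [y zFy xy] := cap _ eps2_gt0.
exists y; split=> //; apply: lB.
have /cvg_ballP/(_ _ eps2_gt0) xl_eps := xl.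
near (pinfty_nbhs R) => t.
rewrite (splitr eps); apply: (@ball_triangle _ _ (x t)); first by near: t.
by rewrite ballEmdist/=; apply: xy; near: t; apply: nbhs_pinfty_ge; exact: num_real.
Unshelve. all: by end_near. Qed.

Lemma zero_capture_converges F x rho :
  metric_complete X -> closed (zer F) -> zero_capture F x rho ->
  exists2 l, zer F l & converges_with_rate x l (fun eps => rho (eps / 2)).
Proof.
move=> Xcomplete zF_closed cap.
have [l [xl rate]] :=
  cauchy_rate_converges Xcomplete (zero_capture_cauchy_rate cap).
by exists l => //; exact: zero_capture_limit zF_closed cap xl.
Qed.

End Capture.

Section Fejer.
Context {R : realType} {X : metricType R}.
Variables (F : X -> \bar R) (x : R -> X) (z : X) (b : R) (tau : R -> R).
Variables (G H g h : R -> R) (e : R -> R -> R).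
Hypothesis zF : zer F z.
Hypothesis x_bounded : forall t, 0 <= t -> mdist (x t) z <= b.
Hypothesis tauP : modulus_of_regularity F z b tau.
Hypothesis g_gt0 : forall eps, 0 < eps -> 0 < g eps.
Hypothesis h_gt0 : forall eps, 0 < eps -> 0 < h eps.
Hypothesis gG : forall a eps, 0 <= a -> 0 < eps -> a < g eps -> G a < eps.
Hypothesis hH : forall a eps, 0 <= a -> 0 < eps -> H a < h eps -> a < eps.
Hypothesis x_fejer : forall y s t, zer F y -> 0 <= s -> s <= t ->
  H (mdist (x t) y) <= G (mdist (x s) y) + e s t.

(** The budget [c] is the share of [h eps] left to [G]; the errors after time
    [s] may use up the rest. *)
Lemma visit_capture (s c eps : R) : 0 <= s -> 0 < c -> 0 < eps ->
    (forall t, s <= t -> c + e s t <= h eps) -> (F (x s) < (tau (g c))%:E)%E ->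
  exists2 y, zer F y & forall t, s <= t -> mdist (x t) y < eps.
Proof.
move=> s_ge0 c_gt0 eps_gt0 e_small Fxs.
have xs_ball : cball z b (x s) by rewrite /cball/= metric_sym; exact: x_bounded.
have := tauP.2 _ _ (g_gt0 c_gt0) xs_ball Fxs.
move=> /(dist_lt_ex (ex_intro _ z zF))[y zFy xsy].
exists y => // t st; apply: hH => //; first exact: mdist_ge0.
apply: le_lt_trans (x_fejer zFy s_ge0 st) _.
apply: lt_le_trans (e_small t st).
by rewrite ltrD2r; apply: gG => //; exact: mdist_ge0.
Qed.

Lemma liminf_bound_capture (phi : R -> nat -> nat) (eta : R -> nat) :
    liminf_bound F x phi -> error_rate e eta ->
  zero_capture F x
    (fun eps => (phi (tau (g (h eps / 2))) (eta (h eps / 2)%R) + 1)%N).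
Proof.
move=> phiP etaP eps eps_gt0.
have c_gt0 : 0 < h eps / 2 by rewrite divr_gt0 ?h_gt0.
have [s [/andP[eta_s s_phi] Fxs]] :=
  phiP _ (eta (h eps / 2)) (tauP.1 _ (g_gt0 c_gt0)).
have [|y zFy xy] := visit_capture (le_trans (ler0n _ _) eta_s) c_gt0 eps_gt0 _ Fxs.
  move=> t st; rewrite [leRHS]splitr lerD2l.
  by apply: le_trans (ler_norm _) _; exact/ltW/etaP.
exists y => // t rho_t; apply: xy; apply: le_trans s_phi _.
by apply: le_trans rho_t; rewrite ler_nat leq_addr.
Qed.

Lemma approx_zero_bound_capture (phi : R -> nat) :
    (forall s t, 0 <= s -> s <= t -> e s t = 0) -> approx_zero_bound F x phi ->
  zero_capture F x (fun eps => (phi (tau (g (h eps))) + 1)%N).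
Proof.
move=> e0 phiP eps eps_gt0.
have [s [/andP[s_ge0 s_phi] Fxs]] := phiP _ (tauP.1 _ (g_gt0 (h_gt0 eps_gt0))).
have [|y zFy xy] := visit_capture s_ge0 (h_gt0 eps_gt0) eps_gt0 _ Fxs.
  by move=> t st; rewrite e0// addr0.
exists y => // t rho_t; apply: xy; apply: le_trans s_phi _.
by apply: le_trans rho_t; rewrite ler_nat leq_addr.
Qed.

End Fejer.

Theorem theorem3p18 (R : realType) (X : metricType R)
    (F : X -> \bar R) (F_ge0 : forall y, (0 <= F y)%E)
    (x : R -> X) (z : X) (zF : zer F z) (b : R) (b_gt0 : 0 < b)
    (x_bounded : forall t, 0 <= t -> mdist (x t) z <= b)
    (tau : R -> R) (tauP : modulus_of_regularity F z b tau)
    (G H g h : R -> R)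
    (G_ge0 : forall a, 0 <= a -> 0 <= G a)
    (H_ge0 : forall a, 0 <= a -> 0 <= H a)
    (g_gt0 : forall eps, 0 < eps -> 0 < g eps)
    (h_gt0 : forall eps, 0 < eps -> 0 < h eps)
    (gG : forall a eps, 0 <= a -> 0 < eps -> a < g eps -> G a < eps)
    (hH : forall a eps, 0 <= a -> 0 < eps -> H a < h eps -> a < eps)
    (e : R -> R -> R)
    (x_fejer : forall y s t, zer F y -> 0 <= s -> s <= t ->
       H (mdist (x t) y) <= G (mdist (x s) y) + e s t) :
  let rho_a (phi : R -> nat -> nat) (eta : R -> nat) (eps : R) : nat :=
    (phi (tau (g (h eps / 2))) (eta (h eps / 2)) + 1)%N in
  let rho_b (phi : R -> nat) (eps : R) : nat :=
    (phi (tau (g (h eps))) + 1)%N in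
  let e_zero := forall s t, 0 <= s -> s <= t -> e s t = 0 in
  [/\ (forall (phi : R -> nat -> nat) (eta : R -> nat),
         liminf_bound F x phi -> error_rate e eta ->
         dist_rate F x (rho_a phi eta) /\
         cauchy_rate x (fun eps => rho_a phi eta (eps / 2))),
      (forall phi : R -> nat,
         e_zero -> approx_zero_bound F x phi ->
         dist_rate F x (rho_b phi) /\
         cauchy_rate x (fun eps => rho_b phi (eps / 2))) &
      (metric_complete X -> closed (zer F) ->
         (forall (phi : R -> nat -> nat) (eta : R -> nat),
            liminf_bound F x phi -> error_rate e eta ->
            exists2 l : X, zer F l &
              converges_with_rate x l (fun eps => rho_a phi eta (eps / 2))) /\
         (forall phi : R -> nat,
            e_zero -> approx_zero_bound F x phi ->
            exists2 l : X, zer F l &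
              converges_with_rate x l (fun eps => rho_b phi (eps / 2))))].
Proof.
move=> rho_a rho_b e_zero.
have cap_a phi eta : liminf_bound F x phi -> error_rate e eta ->
    zero_capture F x (rho_a phi eta).
  exact: (liminf_bound_capture zF x_bounded tauP g_gt0 h_gt0 gG hH x_fejer).
have cap_b phi : e_zero -> approx_zero_bound F x phi ->
    zero_capture F x (rho_b phi).
  exact: (approx_zero_bound_capture zF x_bounded tauP g_gt0 h_gt0 gG hH x_fejer).
split=> [phi eta phiP etaP|phi e0 phiP|Xcomplete zF_closed].
- have cap := cap_a _ _ phiP etaP; split.
    exact: zero_capture_dist_rate cap.
  exact: zero_capture_cauchy_rate cap.
- have cap := cap_b _ e0 phiP; split.
    exact: zero_capture_dist_rate cap.
  exact: zero_capture_cauchy_rate cap.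
- split=> [phi eta phiP etaP|phi e0 phiP].
    exact: zero_capture_converges (cap_a _ _ phiP etaP).
  exact: zero_capture_converges (cap_b _ e0 phiP).
Qed.
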